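(* Let $n\ge 1$ and let $u=(u_1,\dots,u_n) \in (\mathbb{C}\langle x_1,\dots,x_n\rangle \otimes \mathbb{C}\langle x_1,\dots,x_n\rangle)^n$. Then the following statements are equivalent: (i) $u$ is a free gradient, i.e., there exists $q\in \mathbb{C}\langle x_1,\dots,x_n\rangle$ such that $u_i = \partial_i q$ for $i=1,\dots,n$. (ii) There exists $q\in \mathbb{C}\langle x_1,\dots,x_n\rangle$ such that $\sum_{j=1}^n u_j \sharp [x_j, 1\otimes 1] = [q, 1\otimes 1]$. (iii) For $i,j=1,\dots,n$, we have $(\mathrm{id} \otimes \partial_i)(u_j) = (\partial_j \otimes \mathrm{id})(u_i)$. (iv) For $i=1,\dots,n$, we have $\partial_i \big( \sum_{j=1}^n u_j \sharp x_j \big) = (N \otimes \mathrm{id} + \mathrm{id} \otimes N + \mathrm{id} \otimes \mathrm{id})(u_i)$. In the case that the equivalent conditions are satisfied, the noncommutative polynomials $q$ in (i) and (ii) differ only by an additive constant, so that every $q$ which satisfies one of the conditions (i), (ii) satisfies also the other; such a $q$ can be found by solving the equation $Nq=\sum_{j=1}^n u_j\sharp x_j$, that is, this equation has a solution $q\in\mathbb{C}\langle x_1,\dots,x_n\rangle$ and every solution $q$ satisfies $\partial_iq=u_i$ for all $i=1,\dots,n$.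
   Context: $\mathbb{C}\langle x_1,\dots,x_n\rangle$ is the unital complex algebra of noncommutative polynomials in formal non-commuting variables $x_1,\dots,x_n$ (the free algebra); $\otimes$ is the algebraic tensor product over $\mathbb{C}$; $\mathrm{id}$ is the identity map on $\mathbb{C}\langle x_1,\dots,x_n\rangle$. The noncommutative derivatives are the linear maps $\partial_j:\mathbb{C}\langle x_1,\dots,x_n\rangle\to\mathbb{C}\langle x_1,\dots,x_n\rangle\otimes\mathbb{C}\langle x_1,\dots,x_n\rangle$ with $\partial_j1=0$ and $\partial_j(x_{i_1}\cdots x_{i_k})=\sum_{p=1}^k\delta_{j,i_p}\,x_{i_1}\cdots x_{i_{p-1}}\otimes x_{i_{p+1}}\cdots x_{i_k}$. The number operator $N$ is the linear map on $\mathbb{C}\langle x_1,\dots,x_n\rangle$ with $N1=0$ and $N(x_{i_1}\cdots x_{i_k})=k\,x_{i_1}\cdots x_{i_k}$. Notation: $(p_1\otimes p_2)\sharp x_j=p_1x_jp_2$; $[q,1\otimes1]=q\otimes1-1\otimes q$; and $(p_1\otimes p_2)\sharp[x_j,1\otimes1]=p_1x_j\otimes p_2-p_1\otimes x_jp_2$; the operations $u\mapsto u\sharp x_j$ and $u\mapsto u\sharp[x_j,1\otimes 1]$ are extended linearly in $u\in\mathbb{C}\langle x_1,\dots,x_n\rangle\otimes\mathbb{C}\langle x_1,\dots,x_n\rangle$. *)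

(* Defs.v *)
From HB Require Import structures.
From mathcomp Require Import all_boot all_order all_algebra.
From mathcomp Require Import finmap.
From mathcomp Require Export complex.
From mathcomp Require Export reals.
From mathcomp Require Export monalg.

Set Implicit Arguments.
Unset Strict Implicit.
Unset Printing Implicit Defensive.

Import GRing.Theory.

Local Open Scope fset_scope.
Local Open Scope ring_scope.

Reserved Notation "p ⊗ q" (at level 40, left associativity).

Section LinearExtension.
Context (F : fieldType).

(* The linear map determined by its values f on the basis (<< k >>) k of the
   free module {malg F[K]}. *)
Definition lext (K : choiceType) (V : lmodType F) (f : K -> V)
    (g : {malg F[K]}) : V :=
  \sum_(k <- msupp g) g@_k *: f k.

Lemma lextEw (K : choiceType) (V : lmodType F) (f : K -> V) (d : {fset K}) g :
  msupp g `<=` d -> lext f g = \sum_(k <- d) g@_k *: f k.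
Proof.
move=> le; rewrite /lext (big_fset_incl _ le) // => k _ /mcoeff_outdom ->.
by rewrite scale0r.
Qed.

Lemma lextU (K : choiceType) (V : lmodType F) (f : K -> V) k :
  lext f << k >> = f k.
Proof. by rewrite (lextEw _ msuppU_le) big_seq_fset1 mcoeffUU scale1r. Qed.

Lemma lext_is_linear (K : choiceType) (V : lmodType F) (f : K -> V) :
  linear (lext f).
Proof.
move=> a g h; pose d := msupp g `|` msupp h.
have leg : msupp g `<=` d by exact: fsubsetUl.
have leh : msupp h `<=` d by exact: fsubsetUr.
have leZ : msupp (a *: g) `<=` d by exact: fsubset_trans (msuppZ_le _ _) leg.
have leD : msupp (a *: g + h) `<=` d.
  by apply: fsubset_trans (msuppD_le _ _) _; rewrite fsubUset leZ leh.
rewrite !(@lextEw _ _ _ d) // scaler_sumr -big_split; apply: eq_bigr => k _.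
by rewrite mcoeffD mcoeffZ scalerDl scalerA.
Qed.

HB.instance Definition _ (K : choiceType) (V : lmodType F) (f : K -> V) :=
  GRing.isLinear.Build F {malg F[K]} V *:%R (lext f) (lext_is_linear f).

Lemma malg_expand (K : choiceType) (g : {malg F[K]}) :
  g = \sum_(k <- msupp g) g@_k *: << k >>.
Proof.
rewrite {1}[g]monalgE; apply: eq_bigr => k _; apply/malgP => l.
by rewrite mcoeffZ !mcoeffU mulrnAr mulr1.
Qed.

Lemma lext_uniq (K : choiceType) (V : lmodType F)
    (f : {linear {malg F[K]} -> V}) g : f g = lext (fun k => f << k >>) g.
Proof.
rewrite {1}[g]malg_expand linear_sum; apply: eq_bigr => k _.
by rewrite linearZ.
Qed.

End LinearExtension.

(* The algebraic tensor product of the free modules on K and L is the free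
   module on K * L, the vectors << k >> ⊗ << l >> forming a basis; its
   universal property is given by tliftE and tlift_uniq. *)
Notation tensor F K L := {malg F[(K * L)%type]}.

Section Tensor.
Context (F : fieldType).

Definition tens (K L : choiceType) (p : {malg F[K]}) (q : {malg F[L]}) :
    tensor F K L :=
  \sum_(k <- msupp p) \sum_(l <- msupp q) (p@_k * q@_l) *: << (k, l) >>.

Local Notation "p ⊗ q" := (tens p q).

(* The linear map on the tensor product with p ⊗ q |-> b p q, for b
   bilinear. *)
Definition tlift (K L : choiceType) (V : lmodType F)
    (b : {malg F[K]} -> {malg F[L]} -> V) : tensor F K L -> V :=
  lext (fun kl => b << kl.1 >> << kl.2 >>).

HB.instance Definition _ (K L : choiceType) (V : lmodType F)
    (b : {malg F[K]} -> {malg F[L]} -> V) :=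
  GRing.Linear.copy (tlift b) (lext (fun kl => b << kl.1 >> << kl.2 >>)).

Lemma tensUU (K L : choiceType) (k : K) (l : L) :
  << k >> ⊗ << l >> = << (k, l) >> :> tensor F K L.
Proof. by rewrite /tens !msuppU oner_eq0 !big_seq_fset1 !mcoeffUU mul1r scale1r. Qed.

Lemma tensE (K L : choiceType) (p : {malg F[K]}) (q : {malg F[L]}) :
  p ⊗ q = lext (fun k => lext (fun l => << (k, l) >>) q) p.
Proof.
apply: eq_bigr => k _; rewrite scaler_sumr; apply: eq_bigr => l _.
by rewrite scalerA.
Qed.

Lemma tens_linearl (K L : choiceType) (q : {malg F[L]}) :
  linear (fun p : {malg F[K]} => p ⊗ q).
Proof. by move=> a p p'; rewrite !tensE linearP. Qed.

Lemma tens_linearr (K L : choiceType) (p : {malg F[K]}) :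
  linear (fun q : {malg F[L]} => p ⊗ q).
Proof.
move=> a q q'; rewrite !tensE !(lextEw _ (fsubset_refl (msupp p))) scaler_sumr -big_split.
apply: eq_bigr => k _ /=.
by rewrite linearP scalerDr !scalerA mulrC.
Qed.

Lemma tliftE (K L : choiceType) (V : lmodType F)
    (b : {malg F[K]} -> {malg F[L]} -> V) p q :
    (forall q, linear (b^~ q)) -> (forall p, linear (b p)) ->
  tlift b (p ⊗ q) = b p q.
Proof.
move=> bl br.
pose bL q := GRing.isLinear.Build F _ V *:%R (b^~ q) (bl q).
pose bR p := GRing.isLinear.Build F _ V *:%R (b p) (br p).
pose fL q : {linear {malg F[K]} -> V} := HB.pack (b^~ q) (bL q).
pose fR p : {linear {malg F[L]} -> V} := HB.pack (b p) (bR p).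
rewrite -[RHS]/(fL q p) lext_uniq /tens linear_sum; apply: eq_bigr => k _.
rewrite -[fL q _]/(fR << k >> q) lext_uniq linear_sum scaler_sumr.
by apply: eq_bigr => l _; rewrite linearZ scalerA /= /tlift lextU.
Qed.

Lemma tlift_uniq (K L : choiceType) (V : lmodType F)
    (f : {linear tensor F K L -> V}) u :
  f u = tlift (fun p q => f (p ⊗ q)) u.
Proof.
by rewrite lext_uniq; apply: eq_bigr => -[k l] _; rewrite tensUU.
Qed.

(* f ⊗ g, for f and g linear. *)
Definition tmap (K L K' L' : choiceType)
    (f : {malg F[K]} -> {malg F[K']}) (g : {malg F[L]} -> {malg F[L']}) :
    tensor F K L -> tensor F K' L' :=
  tlift (fun p q => f p ⊗ g q).

(* The canonical identification (p ⊗ q) ⊗ r |-> p ⊗ (q ⊗ r). *)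
Definition tassoc (K L M : choiceType) :
    tensor F (K * L)%type M -> tensor F K (L * M)%type :=
  tlift (fun u r => tlift (fun p q => p ⊗ (q ⊗ r)) u).

Lemma tmapE (K L K' L' : choiceType)
    (f : {linear {malg F[K]} -> {malg F[K']}})
    (g : {linear {malg F[L]} -> {malg F[L']}}) p q :
  tmap f g (p ⊗ q) = f p ⊗ g q.
Proof.
by apply: tliftE => [q'|p'] a x y; rewrite linearP (tens_linearl, tens_linearr).
Qed.

Lemma tassocE (K L M : choiceType)
    (p : {malg F[K]}) (q : {malg F[L]}) (r : {malg F[M]}) :
  tassoc ((p ⊗ q) ⊗ r) = p ⊗ (q ⊗ r).
Proof.
rewrite /tassoc tliftE => [|r'|u]; last 2 first.
- exact: linearP.
- move=> a x y; rewrite /tlift !(lextEw _ (fsubset_refl (msupp u))).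
  rewrite scaler_sumr -big_split; apply: eq_bigr => k _ /=.
  by rewrite !tens_linearr scalerDr !scalerA mulrC.
apply: tliftE => [q'|p'] a x y; first by rewrite tens_linearl.
by rewrite tens_linearl tens_linearr.
Qed.

End Tensor.

Notation "p ⊗ q" := (tens p q) : ring_scope.

(* F<x_1, ..., x_n>: {fmonom 'I_n} is the free monoid of words in the letters
   'I_n, and << w >> is the monomial of the word w (see monom_prod). *)
Notation ncpoly F n := {malg F[{fmonom 'I_n}]}.
Notation ncpoly2 F n := (tensor F {fmonom 'I_n} {fmonom 'I_n}).

Section NoncommutativePolynomials.
Context (F : fieldType) (n : nat).

Definition ncvar (j : 'I_n) : ncpoly F n := << fmu j >>.

Definition ncder (j : 'I_n) : ncpoly F n -> ncpoly2 F n :=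
  lext (fun w : {fmonom 'I_n} => \sum_(p < size w)
    (j == tnth (in_tuple w) p)%:R *:
      (<< FMonom (take p w) >> ⊗ << FMonom (drop p.+1 w) >>)).

Definition number_op : ncpoly F n -> ncpoly F n :=
  lext (fun w : {fmonom 'I_n} => (size w)%:R *: << w >>).

(* u ♯ x_j *)
Definition sharp (j : 'I_n) : ncpoly2 F n -> ncpoly F n :=
  tlift (fun p1 p2 => p1 * ncvar j * p2).

(* u ♯ [x_j, 1 ⊗ 1] *)
Definition sharp_comm (j : 'I_n) : ncpoly2 F n -> ncpoly2 F n :=
  tlift (fun p1 p2 => (p1 * ncvar j) ⊗ p2 - p1 ⊗ (ncvar j * p2)).

(* [q, 1 ⊗ 1] *)
Definition comm11 (q : ncpoly F n) : ncpoly2 F n := q ⊗ 1 - 1 ⊗ q.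

Lemma monom_prod (s : seq 'I_n) : << FMonom s >> = \prod_(i <- s) ncvar i.
Proof.
elim: s => [|i s IHs]; first by rewrite big_nil -fmoneE.
rewrite big_cons -IHs /ncvar malgM_def fgmulUU mulr1; congr mkmalgU.
by apply/eqP; rewrite fmP fmM fmU.
Qed.

Lemma ncder1 j : ncder j 1 = 0.
Proof. by rewrite /ncder lextU fm1 big_ord0. Qed.

Lemma ncderU j (s : seq 'I_n) :
  ncder j << FMonom s >> = \sum_(p < size s) (j == tnth (in_tuple s) p)%:R *:
    (<< FMonom (take p s) >> ⊗ << FMonom (drop p.+1 s) >>).
Proof. exact: lextU. Qed.

Lemma number_opU (s : seq 'I_n) :
  number_op << FMonom s >> = (size s)%:R *: << FMonom s >>.
Proof. exact: lextU. Qed.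

Let malg_scaleAr (a : F) (p q : ncpoly F n) : p * (a *: q) = a *: (p * q).
Proof.
apply/malgP => k; rewrite mcoeffZ !(@mcoeffMlw _ _ (msupp p) (msupp q)) //.
  rewrite mulr_sumr; apply: eq_bigr => k1 _.
  rewrite mulr_sumr; apply: eq_bigr => k2 _.
  by rewrite mcoeffZ mulrCA mulrnAr.
exact: msuppZ_le.
Qed.

Lemma sharpE j p1 p2 : sharp j (p1 ⊗ p2) = p1 * ncvar j * p2.
Proof.
apply: tliftE => [q|p] a x y; first by rewrite !mulrDl -!scalerAl.
by rewrite mulrDr malg_scaleAr.
Qed.

Lemma sharp_commE j p1 p2 :
  sharp_comm j (p1 ⊗ p2) = (p1 * ncvar j) ⊗ p2 - p1 ⊗ (ncvar j * p2).
Proof.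
apply: tliftE => [q|p] a x y.
  by rewrite mulrDl -scalerAl !tens_linearl scalerBr opprD addrACA.
by rewrite mulrDr malg_scaleAr !tens_linearr scalerBr opprD addrACA.
Qed.

End NoncommutativePolynomials.

Arguments number_op {F n} q.

(* Main.v *)
(* On coefficients of words, u = (∂_i q)_i says that the coefficient of a ⊗ b in
   u_i is that of the word a x_i b in q, so each condition becomes an identity
   between coefficients. Moving one letter at a time across the tensor sign
   turns (ii) into (i) with the same q. Under (iii) the coefficient of a ⊗ b
   in u_i depends only on the word w = a x_i b, so the |w| splittings of w
   contribute equally to the coefficient of w in \sum_j u_j ♯ x_j, which is
   (iv). Finally (iv) determines q by dividing by the length |w|, which is
   nonzero for w = a x_i b. *)
Require Import Defs.
From mathcomp Require Import all_boot all_order all_algebra.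
From mathcomp Require Import finmap.

Set Implicit Arguments.
Unset Strict Implicit.
Unset Printing Implicit Defensive.

Import GRing.Theory.
Local Open Scope ring_scope.
Local Open Scope complex_scope.

(** * Coefficients of linear extensions and of tensor maps *)

Section Coefficients.
Context (F : fieldType).

Lemma mcoeff_monom (K : choiceType) (k k' : K) :
  (<< k >> : {malg F[K]})@_k' = (k == k')%:R.
Proof. exact: mcoeffU. Qed.

Lemma mcoeff_lext (K L : choiceType) (f : K -> {malg F[L]}) g l :
  (lext f g)@_l = \sum_(k <- msupp g) g@_k * (f k)@_l.
Proof. by rewrite raddf_sum; apply: eq_bigr => k _ /=; rewrite mcoeffZ. Qed.

(** Both sides are linear in [g], so agreement on basis vectors suffices. This reduces the later
    coefficient formulas to a check on single words. *)
Lemma mcoeff_lext_sum (K L : choiceType) (I : Type) (s : seq I) (m : I -> K)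
    (c : I -> F) (f : K -> {malg F[L]}) (l : L) g :
  (forall k, (f k)@_l = \sum_(i <- s) c i * (k == m i)%:R) ->
  (lext f g)@_l = \sum_(i <- s) c i * g@_(m i).
Proof.
move=> fE; rewrite mcoeff_lext.
under eq_bigr => k _ do rewrite fE mulr_sumr.
rewrite exchange_big; apply: eq_bigr => i _ /=.
rewrite [in RHS](malg_expand g) raddf_sum mulr_sumr.
by apply: eq_bigr => k _ /=; rewrite mcoeffZ mcoeff_monom mulrCA.
Qed.

Lemma mcoeff_lext1 (K L : choiceType) (m : K) (c : F) (f : K -> {malg F[L]})
    (l : L) g :
  (forall k, (f k)@_l = c * (k == m)%:R) -> (lext f g)@_l = c * g@_m.
Proof.
move=> fE; rewrite (@mcoeff_lext_sum _ _ _ [:: tt] (fun=> m) (fun=> c)).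
  by rewrite big_seq1.
by move=> k; rewrite big_seq1.
Qed.

Lemma mcoeff_tens (K L : choiceType) (p : {malg F[K]}) (q : {malg F[L]}) k l :
  (p ⊗ q)@_(k, l) = p@_k * q@_l.
Proof.
rewrite tensE mulrC; apply: mcoeff_lext1 => k'.
rewrite mulrC; apply: mcoeff_lext1 => l'.
by rewrite mcoeff_monom -pair_eqE -natrM mulnb.
Qed.

(** The hypotheses fit the identity, the derivatives, [number_op] and multiplication by a letter:
    each output coefficient is a scalar times one input coefficient. *)
Lemma mcoeff_tmap (K L K' L' : choiceType)
    (f : {malg F[K]} -> {malg F[K']}) (g : {malg F[L]} -> {malg F[L']})
    (c d : F) m m' a b u :
    (forall k, (f << k >>)@_a = c * (k == m)%:R) ->
    (forall l, (g << l >>)@_b = d * (l == m')%:R) ->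
  (tmap f g u)@_(a, b) = c * d * u@_(m, m').
Proof.
move=> fE gE; apply: mcoeff_lext1 => -[k l].
by rewrite mcoeff_tens fE gE mulrACA -pair_eqE -natrM mulnb.
Qed.

Lemma mcoeff_tassoc (K L M : choiceType) (u : tensor F (K * L)%type M) k l m :
  (tassoc u)@_(k, (l, m)) = u@_((k, l), m).
Proof.
rewrite -[RHS]mul1r; apply: mcoeff_lext1 => -[[k' l'] m'] /=.
rewrite /tlift lextU !tensUU mcoeff_monom mul1r; congr (_%:R).
by rewrite -!pair_eqE /= /pair_eq /= -!pair_eqE /= andbA.
Qed.

End Coefficients.

(** * Coefficients of words under derivatives, number operator and [sharp] *)

Section Words.
Context (F : fieldType) (n : nat).
Implicit Types (a b c w : seq 'I_n) (q : ncpoly F n) (u v : ncpoly2 F n).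

Definition coef q a : F := q@_(FMonom a).
Definition coef2 u a b : F := u@_(FMonom a, FMonom b).

Lemma coefP q q' : (forall a, coef q a = coef q' a) -> q = q'.
Proof. by move=> qq'; apply/malgP => -[a]; exact: qq'. Qed.

Lemma coef2P u v : (forall a b, coef2 u a b = coef2 v a b) -> u = v.
Proof. by move=> uv; apply/malgP => -[[a] [b]]; exact: uv. Qed.

Lemma coefB q q' a : coef (q - q') a = coef q a - coef q' a.
Proof. exact: mcoeffB. Qed.

Lemma coef2B u v a b : coef2 (u - v) a b = coef2 u a b - coef2 v a b.
Proof. exact: mcoeffB. Qed.

Lemma coef2D u v a b : coef2 (u + v) a b = coef2 u a b + coef2 v a b.
Proof. exact: mcoeffD. Qed.

Lemma coef_sum (I : finType) (f : I -> ncpoly F n) a :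
  coef (\sum_i f i) a = \sum_i coef (f i) a.
Proof. exact: raddf_sum. Qed.

Lemma coef2_sum (I : finType) (f : I -> ncpoly2 F n) a b :
  coef2 (\sum_i f i) a b = \sum_i coef2 (f i) a b.
Proof. exact: raddf_sum. Qed.

(** Only the position [p = size a] can split [w] with prefix [a], so at most one term survives. *)
Lemma sum_splittings (i : 'I_n) a b w :
  \sum_(p < size w) (i == tnth (in_tuple w) p)%:R *
    ((take p w == a)%:R * (drop p.+1 w == b)%:R) = (w == a ++ i :: b)%:R :> F.
Proof.
have wE (p : 'I_(size w)) : w = take p w ++ tnth (in_tuple w) p :: drop p.+1 w.
  by rewrite (tnth_nth i) -drop_nth ?cat_take_drop.
have [wab|wab] := eqVneq w; last first.
  apply: big1 => p _; rewrite -!natrM !mulnb.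
  case: and3P => // -[/eqP iE /eqP aE /eqP bE].
  by case/eqP: wab; rewrite (wE p) aE bE -iE.
have aw : (size a < size w)%N by rewrite wab size_cat /= addnS ltnS leq_addr.
rewrite (bigD1 (Ordinal aw)) //= big1 ?addr0 => [|p].
  rewrite (tnth_nth i) /= wab take_size_cat // -cat_rcons drop_size_cat.
    by rewrite cat_rcons nth_cat ltnn subnn !eqxx !mul1r.
  by rewrite size_rcons.
rewrite -val_eqE /= => pa; case: (take p w =P a) => [ta|_]; last by rewrite mul0r mulr0.
by case/eqP: pa; rewrite -ta size_takel // ltnW.
Qed.

(** The factor [1] is kept to match the hypotheses of [mcoeff_tmap]. *)
Lemma mcoeff_ncderU (i : 'I_n) (k : {fmonom 'I_n}) a b :
  (ncder i << k >> : ncpoly2 F n)@_(FMonom a, FMonom b) =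
  1 * (k == FMonom (a ++ i :: b))%:R.
Proof.
rewrite mul1r fmP /= -sum_splittings /ncder lextU raddf_sum.
apply: eq_bigr => p _ /=; rewrite mcoeffZ tensUU mcoeff_monom -pair_eqE /=.
by rewrite /pair_eq /= !fmP /= -natrM mulnb.
Qed.

Lemma coef2_ncder (i : 'I_n) q a b :
  coef2 (ncder i q) a b = coef q (a ++ i :: b).
Proof.
rewrite -[RHS]mul1r; apply: mcoeff_lext1 => k.
by rewrite -mcoeff_ncderU /ncder lextU.
Qed.

Lemma mcoeff_number_opU (k m : {fmonom 'I_n}) :
  (number_op << k >> : ncpoly F n)@_m = (size m)%:R * (k == m)%:R.
Proof.
rewrite /number_op lextU mcoeffZ mcoeff_monom.
by case: eqVneq => [->|]; rewrite ?mulr0.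
Qed.

Lemma coef_number_op q a : coef (number_op q) a = (size a)%:R * coef q a.
Proof.
apply: mcoeff_lext1 => k.
by rewrite -(mcoeff_number_opU k (FMonom a)) /number_op lextU.
Qed.

Lemma coef_sharp (j : 'I_n) u w :
  coef (sharp j u) w = \sum_(p < size w)
    (j == tnth (in_tuple w) p)%:R * coef2 u (take p w) (drop p.+1 w).
Proof.
apply: (mcoeff_lext_sum
  (m := fun p : 'I_(size w) => (FMonom (take p w), FMonom (drop p.+1 w)))).
move=> -[[a] [b]] /=; rewrite /ncvar !malgM_def !fgmulUU !mulr1 mcoeff_monom.
rewrite fmP !fmM fmU /= -catA /= eq_sym -sum_splittings.
apply: eq_bigr => p _; rewrite -pair_eqE /= /pair_eq /= !fmP /=.
by rewrite -natrM mulnb ![_ == take _ _]eq_sym ![_ == drop _ _]eq_sym.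
Qed.

Lemma sum_delta (f : 'I_n -> F) k : \sum_(j < n) (j == k)%:R * f j = f k.
Proof.
rewrite (bigD1 k) //= eqxx mul1r big1 ?addr0 // => j /negPf->.
by rewrite mul0r.
Qed.

Lemma coef_sum_sharp (f : 'I_n -> ncpoly2 F n) w :
  coef (\sum_(j < n) sharp j (f j)) w = \sum_(p < size w)
    coef2 (f (tnth (in_tuple w) p)) (take p w) (drop p.+1 w).
Proof.
rewrite coef_sum; under eq_bigr => j _ do rewrite coef_sharp.
rewrite exchange_big; apply: eq_bigr => p _ /=.
by rewrite (sum_delta (fun j => coef2 (f j) _ _)).
Qed.

(** * Multiplication by a letter on either side of the tensor sign *)

Definition mulxl (j : 'I_n) : ncpoly2 F n -> ncpoly2 F n :=
  tmap (fun p => p * ncvar F j) idfun.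
Definition mulxr (j : 'I_n) : ncpoly2 F n -> ncpoly2 F n :=
  tmap idfun (fun p => ncvar F j * p).

Lemma sharp_comm_mulx j u : sharp_comm j u = mulxl j u - mulxr j u.
Proof.
by rewrite -sumrB; apply: eq_bigr => k _; rewrite -scalerBr.
Qed.

Lemma coef2_mulxl_nil j u b : coef2 (mulxl j u) [::] b = 0.
Proof.
(* No word ending in [j] is empty, so the scalar is 0 and the word [[::]] on the right is an
   arbitrary choice. *)
rewrite -(mul0r (coef2 u [::] b)) -[X in X * _]mulr1.
apply: mcoeff_tmap => -[a]; last by rewrite mcoeff_monom mul1r.
rewrite /ncvar malgM_def fgmulUU mulr1 mcoeff_monom fmP fmM fmU /= mul0r.
by case: a.
Qed.

Lemma coef2_mulxl_rcons j u a k b :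
  coef2 (mulxl j u) (rcons a k) b = (j == k)%:R * coef2 u a b.
Proof.
rewrite -[X in X * _]mulr1.
apply: mcoeff_tmap => -[d]; last by rewrite mcoeff_monom mul1r.
rewrite /ncvar malgM_def fgmulUU mulr1 mcoeff_monom !fmP fmM fmU /= cats1.
by rewrite eqseq_rcons -mulnb natrM mulrC.
Qed.

Lemma coef2_mulxr_nil j u a : coef2 (mulxr j u) a [::] = 0.
Proof.
rewrite -(mul0r (coef2 u a [::])) -[X in X * _]mul1r.
apply: mcoeff_tmap => -[b]; first by rewrite mcoeff_monom mul1r.
by rewrite /ncvar malgM_def fgmulUU mulr1 mcoeff_monom fmP fmM fmU /= mul0r.
Qed.

Lemma coef2_mulxr_cons j u a k b :
  coef2 (mulxr j u) a (k :: b) = (j == k)%:R * coef2 u a b.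
Proof.
rewrite -[X in X * _]mul1r.
apply: mcoeff_tmap => -[d]; first by rewrite mcoeff_monom mul1r.
rewrite /ncvar malgM_def fgmulUU mulr1 mcoeff_monom !fmP fmM fmU /=.
by rewrite eqseq_cons -mulnb natrM.
Qed.

Lemma coef2_sum_sharp_comm (f : 'I_n -> ncpoly2 F n) (x y : F) a b :
    \sum_(j < n) coef2 (mulxl j (f j)) a b = x ->
    \sum_(j < n) coef2 (mulxr j (f j)) a b = y ->
  coef2 (\sum_(j < n) sharp_comm j (f j)) a b = x - y.
Proof.
move=> <- <-; rewrite coef2_sum -sumrB; apply: eq_bigr => j _.
by rewrite sharp_comm_mulx coef2B.
Qed.

Lemma sum_mulxl_nil (f : 'I_n -> ncpoly2 F n) b :
  \sum_(j < n) coef2 (mulxl j (f j)) [::] b = 0.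
Proof. by apply: big1 => j _; exact: coef2_mulxl_nil. Qed.

Lemma sum_mulxr_nil (f : 'I_n -> ncpoly2 F n) a :
  \sum_(j < n) coef2 (mulxr j (f j)) a [::] = 0.
Proof. by apply: big1 => j _; exact: coef2_mulxr_nil. Qed.

Lemma sum_mulxl_rcons (f : 'I_n -> ncpoly2 F n) a k b :
  \sum_(j < n) coef2 (mulxl j (f j)) (rcons a k) b = coef2 (f k) a b.
Proof.
rewrite -(sum_delta (fun j => coef2 (f j) a b)).
by apply: eq_bigr => j _; exact: coef2_mulxl_rcons.
Qed.

Lemma sum_mulxr_cons (f : 'I_n -> ncpoly2 F n) a k b :
  \sum_(j < n) coef2 (mulxr j (f j)) a (k :: b) = coef2 (f k) a b.
Proof.
rewrite -(sum_delta (fun j => coef2 (f j) a b)).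
by apply: eq_bigr => j _; exact: coef2_mulxr_cons.
Qed.

Lemma coef1 a : coef 1 a = (a == [::])%:R.
Proof. by rewrite /coef mcoeff1 fmP fm1. Qed.

Lemma coef2_comm11 q a b :
  coef2 (comm11 q) a b = coef q a * (b == [::])%:R - (a == [::])%:R * coef q b.
Proof.
by rewrite /comm11 coef2B -!coef1; congr (_ - _); exact: mcoeff_tens.
Qed.

End Words.

(** Two letters marked in the same word, [x1] to the left of [x2], cut it into three pieces; [c] is
    the middle one. *)
Lemma cat_cons_eq (T : Type) (a1 b1 a2 b2 : seq T) x1 x2 :
  (size a1 < size a2)%N -> a1 ++ x1 :: b1 = a2 ++ x2 :: b2 ->
  exists2 c, a2 = a1 ++ x1 :: c & b1 = c ++ x2 :: b2.
Proof.
elim: a1 a2 => [|y a1 IHa] [|z a2] //= lt [-> e]; first by exists a2.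
by have [c -> ->] := IHa a2 lt e; exists c.
Qed.

(** * The four conditions as coefficient identities, and the implications between them *)

Section FreeGradients.
Context (F : numFieldType) (n : nat) (u : 'I_n -> ncpoly2 F n).
Implicit Types (q : ncpoly F n) (a b c : seq 'I_n).

Lemma gradientP q : (forall i, u i = ncder i q) <->
  (forall i a b, coef2 (u i) a b = coef q (a ++ i :: b)).
Proof.
split=> uq i; first by move=> a b; rewrite uq coef2_ncder.
by apply: coef2P => a b; rewrite coef2_ncder.
Qed.

(* Comparing the coefficients of [1 ⊗ x_k b] gives the claim for [u_k] on
   [1 ⊗ b], and those of [a x_l ⊗ x_k b] move [x_l] across the tensor sign. *)
Lemma gradient_commutator q : (forall i, u i = ncder i q) <->
  \sum_(j < n) sharp_comm j (u j) = comm11 q.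
Proof.
have rcons_eq0 a k : (rcons a k == [::]) = false by case: a.
split=> [/gradientP uq|uq].
  apply: coef2P => a b; rewrite coef2_comm11.
  (* The left term sees only the last letter of [a], the right term only the first letter of [b].
     When both words are nonempty, both terms are the coefficient of [q] at [a ++ b] and cancel. *)
  case: (lastP a) b => [|a' k] [|l b].
  - rewrite (coef2_sum_sharp_comm (sum_mulxl_nil _ _) (sum_mulxr_nil _ _)).
    by rewrite !eqxx mulr1 mul1r !subrr.
  - rewrite (coef2_sum_sharp_comm (sum_mulxl_nil _ _) (sum_mulxr_cons _ _ _ _)).
    by rewrite uq eqxx mulr0 mul1r.
  - rewrite (coef2_sum_sharp_comm (sum_mulxl_rcons _ _ _ _) (sum_mulxr_nil _ _)).
    by rewrite uq rcons_eq0 cats1 mulr1 mul0r.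
  - rewrite (coef2_sum_sharp_comm (sum_mulxl_rcons _ _ _ _)
      (sum_mulxr_cons _ _ _ _)).
    by rewrite !uq rcons_eq0 mulr0 mul0r cat_rcons !subrr.
apply/gradientP => k a b; elim/last_ind: a k b => [|a l IHa] k b.
  have := coef2_sum_sharp_comm (sum_mulxl_nil u (k :: b))
    (sum_mulxr_cons u [::] k b).
  by rewrite uq coef2_comm11 eqxx mulr0 mul1r !sub0r => /oppr_inj.
have := coef2_sum_sharp_comm (sum_mulxl_rcons u a l (k :: b))
  (sum_mulxr_cons u (rcons a l) k b).
rewrite uq coef2_comm11 rcons_eq0 mulr0 mul0r subrr cat_rcons -IHa.
by move/esym/subr0_eq.
Qed.

(** At [a ⊗ b ⊗ c], the derivative on the right leg reinserts [i] between [b] and [c], the one on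
    the left leg reinserts [j] between [a] and [b]. *)
Lemma mixed_derivativesP :
  (forall i j, tmap idfun (ncder i) (u j) =
               tassoc (tmap (ncder j) idfun (u i))) <->
  (forall i j a b c,
     coef2 (u j) a (b ++ i :: c) = coef2 (u i) (a ++ j :: b) c).
Proof.
have lE i j a b c :
    (tmap idfun (ncder i) (u j))@_(FMonom a, (FMonom b, FMonom c)) =
    coef2 (u j) a (b ++ i :: c).
  rewrite -[RHS]mul1r -[X in X * _]mul1r; apply: mcoeff_tmap => k.
    by rewrite mcoeff_monom mul1r.
  exact: mcoeff_ncderU.
have rE i j a b c :
    (tassoc (tmap (ncder j) idfun (u i)))@_(FMonom a, (FMonom b, FMonom c)) =
    coef2 (u i) (a ++ j :: b) c.
  rewrite mcoeff_tassoc -[RHS]mul1r -[X in X * _]mul1r.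
  apply: mcoeff_tmap => k; first exact: mcoeff_ncderU.
  by rewrite mcoeff_monom mul1r.
split=> [uu i j a b c|uu i j]; first by rewrite -lE uu rE.
by apply/malgP => -[[a] [[b] [c]]]; rewrite lE rE.
Qed.

(** The three summands scale the coefficient at [a ⊗ b] by [size a], [size b] and 1, which add up to
    the length of [a ++ i :: b]. *)
Lemma number_identityP :
  (forall i, ncder i (\sum_(j < n) sharp j (u j)) =
     tmap number_op idfun (u i) + tmap idfun number_op (u i) +
     tmap idfun idfun (u i)) <->
  (forall i a b, coef (\sum_(j < n) sharp j (u j)) (a ++ i :: b) =
     (size (a ++ i :: b))%:R * coef2 (u i) a b).
Proof.
have idE (k m : {fmonom 'I_n}) :
    (idfun (<< k >> : ncpoly F n))@_m = 1 * (k == m)%:R.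
  by rewrite mcoeff_monom mul1r.
have rE i a b : coef2 (tmap number_op idfun (u i) + tmap idfun number_op (u i) +
     tmap idfun idfun (u i)) a b = (size (a ++ i :: b))%:R * coef2 (u i) a b.
  have NU (k m : {fmonom 'I_n}) := mcoeff_number_opU F k m.
  have -> : (size (a ++ i :: b))%:R * coef2 (u i) a b =
      (size a)%:R * 1 * coef2 (u i) a b + 1 * (size b)%:R * coef2 (u i) a b +
      1 * 1 * coef2 (u i) a b.
    by rewrite -!mulrDl !mulr1 mul1r -natrD natr1 size_cat addnS.
  rewrite !coef2D; congr (_ + _ + _).
  - exact: mcoeff_tmap (NU^~ (FMonom a)) (idE^~ (FMonom b)).
  - exact: mcoeff_tmap (idE^~ (FMonom a)) (NU^~ (FMonom b)).
  - exact: mcoeff_tmap (idE^~ (FMonom a)) (idE^~ (FMonom b)).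
split=> [uu i a b|uu i]; first by rewrite -coef2_ncder uu rE.
by apply: coef2P => a b; rewrite coef2_ncder uu rE.
Qed.

Lemma gradient_mixed q : (forall i, u i = ncder i q) ->
  forall i j, tmap idfun (ncder i) (u j) = tassoc (tmap (ncder j) idfun (u i)).
Proof.
by move=> /gradientP uq; apply/mixed_derivativesP => i j a b c; rewrite !uq -catA.
Qed.

Lemma mixed_number_identity :
  (forall i j, tmap idfun (ncder i) (u j) =
               tassoc (tmap (ncder j) idfun (u i))) ->
  forall i, ncder i (\sum_(j < n) sharp j (u j)) =
     tmap number_op idfun (u i) + tmap idfun number_op (u i) +
     tmap idfun idfun (u i).
Proof.
move=> /mixed_derivativesP uu; apply/number_identityP => i a b.
(* The multiple by the length becomes a constant sum over the positions of the word, to be compared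
   term by term. *)
rewrite coef_sum_sharp mulr_natl -[in RHS](card_ord (size _)) -sumr_const.
apply: eq_bigr => p _; move: p; set w := a ++ i :: b => p.
have : take p w ++ tnth (in_tuple w) p :: drop p.+1 w = a ++ i :: b.
  by rewrite (tnth_nth i) -drop_nth ?cat_take_drop.
move: (take p w) (tnth _ p) (drop p.+1 w) => {p} a' j b'.
(* With [c] the piece between the two marked letters, this is condition (iii) at [a1 ⊗ c ⊗ b2]. *)
have uu_lt (a1 b1 a2 b2 : seq 'I_n) i1 i2 : (size a1 < size a2)%N ->
    a1 ++ i1 :: b1 = a2 ++ i2 :: b2 ->
    coef2 (u i1) a1 b1 = coef2 (u i2) a2 b2.
  by move=> lt /(cat_cons_eq lt)[c -> ->]; exact: uu.
case: (ltngtP (size a') (size a)) => [lt|lt|eq_sz]; first exact: uu_lt.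
- by move/esym/(uu_lt _ _ _ _ _ _ lt).
- by move/eqP; rewrite eqseq_cat // => /andP[/eqP-> /eqP[-> ->]].
Qed.

Lemma sum_sharp_nil : coef (\sum_(j < n) sharp j (u j)) [::] = 0.
Proof. by rewrite coef_sum_sharp big_ord0. Qed.

Lemma number_op_gradient :
  (forall i, ncder i (\sum_(j < n) sharp j (u j)) =
     tmap number_op idfun (u i) + tmap idfun number_op (u i) +
     tmap idfun idfun (u i)) ->
  forall q, number_op q = \sum_(j < n) sharp j (u j) ->
  forall i, u i = ncder i q.
Proof.
move=> /number_identityP uu q Nq; apply/gradientP => i a b.
(* Both sides carry the factor [size (a ++ i :: b)], which is positive and hence nonzero in
   characteristic 0. *)
move: (uu i a b); rewrite -Nq coef_number_op => /esym/mulfI; apply.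
by rewrite Num.Theory.pnatr_eq0 size_cat addnS.
Qed.

Lemma number_op_surj (p : ncpoly F n) : coef p [::] = 0 ->
  exists q, number_op q = p.
Proof.
(* Divide each coefficient by the length of its word. At the empty word the inverse of 0 is 0, and
   [p0] makes the equation hold there. *)
move=> p0; exists (lext (fun w : {fmonom 'I_n} => (size w)%:R^-1 *: << w >>) p).
have qE w : coef (lext (fun w : {fmonom 'I_n} => (size w)%:R^-1 *: << w >>) p) w
    = (size w)%:R^-1 * coef p w.
  apply: mcoeff_lext1 => k; rewrite mcoeffZ mcoeff_monom.
  by case: eqVneq => [->|_] //; rewrite !mulr0.
apply: coefP => w; rewrite coef_number_op qE.
case: w => [|k w]; first by rewrite p0 !mulr0.
by rewrite mulrA mulfV ?mul1r // Num.Theory.pnatr_eq0.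
Qed.

End FreeGradients.

(** The coefficient of [k :: w] is read off from the derivative in [k] at [1 ⊗ w]; only the constant
    term escapes. *)
Lemma gradient_unique (F : numFieldType) n (q q' : ncpoly F n) :
  (forall i, ncder i q = ncder i q') -> q - q' = (coef (q - q') [::])%:A.
Proof.
move=> qq; apply: coefP => w; rewrite {2}/coef mcoeffZ -/(coef 1 w) coef1.
case: w => [|k w]; first by rewrite mulr1.
by rewrite mulr0 coefB -[k :: w]cat0s -!coef2_ncder qq subrr.
Qed.

Theorem theorem1p3 (R : realType) (n : nat) (n_ge1 : (1 <= n)%N)
    (u : 'I_n -> ncpoly2 R[i] n) :
  let gradient_of (q : ncpoly R[i] n) := forall i, u i = ncder i q in
  let commutator_of (q : ncpoly R[i] n) :=
    \sum_(j < n) sharp_comm j (u j) = comm11 q in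
  [<-> exists q, gradient_of q;
       exists q, commutator_of q;
       forall i j, tmap idfun (ncder i) (u j)
                   = tassoc (tmap (ncder j) idfun (u i));
       forall i, ncder i (\sum_(j < n) sharp j (u j))
                 = tmap number_op idfun (u i)
                   + tmap idfun number_op (u i)
                   + tmap idfun idfun (u i)]
  /\ ((exists q, gradient_of q) ->
      [/\ forall q q', gradient_of q \/ commutator_of q ->
            gradient_of q' \/ commutator_of q' ->
            exists c : R[i], q - q' = c%:A,
          forall q, gradient_of q <-> commutator_of q,
          exists q : ncpoly R[i] n, number_op q = \sum_(j < n) sharp j (u j)
        & forall q : ncpoly R[i] n, number_op q = \sum_(j < n) sharp j (u j) ->
            forall i, ncder i q = u i]).
Proof.
move=> gradient_of commutator_of.
have ab q : gradient_of q <-> commutator_of q by exact: gradient_commutator.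
split.
  tfae.
  - by case=> q /ab; exists q.
  - by case=> q /ab/gradient_mixed.
  - exact: mixed_number_identity.
  - move=> iv; have [q Nq] := number_op_surj (sum_sharp_nil u).
    by exists q => i; exact: number_op_gradient.
have gradE q : gradient_of q \/ commutator_of q -> gradient_of q.
  by case=> [gq|/ab gq]; exact: gq.
case=> q0 uq0; split.
- move=> q q' /gradE uq /gradE uq'; exists (coef (q - q') [::]).
  by apply: gradient_unique => i; rewrite -uq -uq'.
- exact: ab.
- exact: number_op_surj (sum_sharp_nil u).
(* A solution [q] need not be the given [q0]; condition (iv), obtained from [q0] through (iii),
   makes it a gradient potential as well. *)
- move=> q Nq i; apply/esym; apply: (number_op_gradient _ Nq).
  exact: (mixed_number_identity (gradient_mixed uq0)).
Qed.
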